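(* Let $l>0$ be real, let $M,N$ be nonnegative integers with $M<N$, and let $(a_0,\dots,a_N)\in\mathbb{R}^{N+1}$. The computational complexity of determining $(b_0,\dots,b_M)$ by using the direct formula $$b_{2m}=a_{2m}+\sum_{n=p+1}^{q}v_{2m,2n}\,a_{2n}\quad(0\le m\le p),\qquad b_{2m+1}=a_{2m+1}+\sum_{n=p_1+1}^{q_1}v_{2m+1,2n+1}\,a_{2n+1}\quad(0\le m\le p_1)$$ is $\mathcal{O}((N-M)M)$, where $p=\lfloor M/2\rfloor$, $p_1=\lfloor (M-1)/2\rfloor$, $q=\lfloor N/2\rfloor$, $q_1=\lfloor (N-1)/2\rfloor$ and the coefficients $v_{i,j}$ are the explicit ones given in the context.
   Context: For integers $0\le m\le p$, $p+1\le n\le q$: $$v_{2m,2n}=\frac{(-1)^{p-m}\,l^{2(n-m)}\,(2n)!}{2^{n-m}(n-m)!\,(p-m)!\,(2m)!}\ \prod_{r=n-p}^{n-m-1}r\ \prod_{r=p+m+1}^{p+n}\frac{1}{2r+1},$$ and for integers $0\le m\le p_1$, $p_1+1\le n\le q_1$: $$v_{2m+1,2n+1}=\frac{(-1)^{p-m}\,l^{2(n-m)}\,(2n+1)!}{2^{n-m}(n-m)!\,(p-m)!\,(2m+1)!}\ \prod_{r=n-p}^{n-m-1}r\ \prod_{r=p+m+2}^{p+n+1}\frac{1}{2r+1}.$$ Empty products equal $1$ and empty sums equal $0$. The numbers $a_0,\dots,a_N$ are the coefficients in the canonical basis $(1,X,\dots,X^N)$ of a real polynomial $P$ of degree $N$,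 and $b_0,\dots,b_M$ are the coefficients of its reduction to degree $M$ on $[-l,l]$. Computational complexity is the number of arithmetic operations on numbers; computed values may be stored and reused, so that entries $v_{i,j}$ may be obtained from neighbouring entries by recurrence.
   Formalization: For M = 0 the stated bound (N-M)M is 0, which fails (e.g. N = 2, where b_0 = a_0 + v_{0,2}a_2 needs operations); the bound O((N-M)M) is proved for all 1 <= M < N with one constant, and for M = 0 the bound is O(N-M) instead. *)

(* Defs.v *)
From HB Require Import structures.
From mathcomp Require Import all_boot all_order all_algebra reals.

Set Implicit Arguments.
Unset Strict Implicit.
Unset Printing Implicit Defensive.

Import Order.TTheory GRing.Theory Num.Theory.

Local Open Scope ring_scope.

(* The coefficients v_{2m,2n} and v_{2m+1,2n+1}; [p] is the parameter written  *)
(* p in the formulas. The natural subtractions are never truncated in the     *)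
(* ranges of [m] and [n] where the coefficients are used.                     *)
Definition v_even (R : realType) (l : R) (p m n : nat) : R :=
  (-1) ^+ (p - m) * l ^+ (2 * (n - m)) * ((2 * n)`!)%:R
    / (2 ^+ (n - m) * ((n - m)`!)%:R * ((p - m)`!)%:R * ((2 * m)`!)%:R)
  * (\prod_(n - p <= r < n - m) r%:R)
  * (\prod_((p + m).+1 <= r < (p + n).+1) (1 / (2 * r + 1)%:R)).

Definition v_odd (R : realType) (l : R) (p m n : nat) : R :=
  (-1) ^+ (p - m) * l ^+ (2 * (n - m)) * ((2 * n + 1)`!)%:R
    / (2 ^+ (n - m) * ((n - m)`!)%:R * ((p - m)`!)%:R * ((2 * m + 1)`!)%:R)
  * (\prod_(n - p <= r < n - m) r%:R)
  * (\prod_((p + m).+2 <= r < (p + n).+2) (1 / (2 * r + 1)%:R)).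

(* The direct formula. Here p = M./2 and q = N./2. The possibly negative      *)
(* p_1 = floor((M-1)/2) and q_1 = floor((N-1)/2) only occur through           *)
(* p_1 + 1 = uphalf M and q_1 + 1 = uphalf N.                                 *)
(* [po] is the value of the parameter p in v_{2m+1,2n+1}; see [odd_param].    *)
Definition b_even (R : realType) (M N : nat) (l : R) (a : seq R) (m : nat) : R :=
  a`_(2 * m) +
  \sum_((M./2).+1 <= n < (N./2).+1) v_even l M./2 m n * a`_(2 * n).

Definition b_odd (R : realType) (M N po : nat) (l : R) (a : seq R) (m : nat)
    : R :=
  a`_(2 * m + 1) +
  \sum_(uphalf M <= n < uphalf N) v_odd l po m n * a`_(2 * n + 1).

Definition b_coef (R : realType) (M N po : nat) (l : R) (a : seq R) (i : nat)
    : R :=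
  if odd i then b_odd M N po l a i./2 else b_even M N l a i./2.

(* The usual formula for v_{2m+1,2n+1} is written with p = floor(M/2). When M *)
(* is odd, p = p_1. When M is even, the coefficients of the reduction are     *)
(* those with p_1 in place of p (with p, v_{1,3} would be 0 for M = 2, whereas *)
(* X^3 reduces to 3/5 l^2 X). Both values are allowed. For M = 0 there is no  *)
(* odd coefficient and the value is irrelevant.                               *)
Definition odd_param (M po : nat) : Prop := po = M./2 \/ po = M.-1./2.

(* Programs without branching. The memory is a sequence of numbers; running   *)
(* an expression appends its value to the memory, where later expressions may *)
(* read it any number of times. The only free constant is 1, so that integers *)
(* such as m, n, p and factorials have to be computed. Reading outside of the *)
(* memory and dividing by 0 are errors.                                       *)
Inductive arith_op := Add | Sub | Mul | Div.

Inductive expr :=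
| One
| Read of nat
| Op of arith_op & expr & expr.

Definition program := seq expr.

Definition apply_op (R : realType) (o : arith_op) (x y : R) : option R :=
  match o with
  | Add => Some (x + y)
  | Sub => Some (x - y)
  | Mul => Some (x * y)
  | Div => if y == 0 then None else Some (x / y)
  end.

Fixpoint eval (R : realType) (mem : seq R) (e : expr) : option R :=
  match e with
  | One => Some 1
  | Read k => onth mem k
  | Op o e1 e2 =>
      obind (fun x => obind (fun y => apply_op o x y) (eval mem e2))
        (eval mem e1)
  end.

Fixpoint run (R : realType) (mem : seq R) (P : program) : option (seq R) :=
  if P is e :: P' then obind (fun x => run (rcons mem x) P') (eval mem e)
  else Some mem.

Fixpoint expr_cost (e : expr) : nat :=
  if e is Op _ e1 e2 then (expr_cost e1 + expr_cost e2).+1 else 0.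

Definition cost (P : program) : nat := \sum_(e <- P) expr_cost e.

(* The initial memory is l, a_0, ..., a_N, so that a_j is at address j + 1.    *)
(* [addr i j] is the address of the stored value of v_{i,j}.                  *)
Definition sum_expr (addr : nat -> nat -> nat) (i : nat) (js : seq nat) : expr :=
  foldl (fun e j => Op Add e (Op Mul (Read (addr i j)) (Read j.+1)))
    (Read i.+1) js.

Definition direct_expr (M N : nat) (addr : nat -> nat -> nat) (i : nat) : expr :=
  sum_expr addr i
    (if odd i then [seq (2 * n + 1)%N | n <- index_iota (uphalf M) (uphalf N)]
     else [seq (2 * n)%N | n <- index_iota (M./2).+1 (N./2).+1]).

(* Compute the coefficients v_{i,j} by means of [T], then evaluate the direct *)
(* formula literally for b_0, ..., b_M.                                       *)
Definition direct_program (M N : nat) (T : program) (addr : nat -> nat -> nat)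
    : program :=
  T ++ [seq direct_expr M N addr i | i <- iota 0 M.+1].

Definition stores_v (R : realType) (M N po : nat) (l : R)
    (addr : nat -> nat -> nat) (mem : seq R) : Prop :=
  (forall m n, (m <= M./2)%N -> (M./2 < n <= N./2)%N ->
     onth mem (addr (2 * m)%N (2 * n)%N) = Some (v_even l M./2 m n)) /\
  (forall m n, (m < uphalf M)%N -> (uphalf M <= n < uphalf N)%N ->
     onth mem (addr (2 * m + 1)%N (2 * n + 1)%N) = Some (v_odd l po m n)).

(* The same program has to work for all l > 0 and all a_0, ..., a_N.           *)
Definition determines_b (R : realType) (M N po : nat) (T : program)
    (addr : nat -> nat -> nat) : Prop :=
  forall (l : R) (a : N.+1.-tuple R), 0 < l ->
  exists mem : seq R,
    [/\ run (l :: a) T = Some mem,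
        stores_v M N po l addr mem &
        run (l :: a) (direct_program M N T addr)
          = Some (mem ++ [seq b_coef M N po l a i | i <- iota 0 M.+1])].

(* The direct formula can be evaluated in at most [c] arithmetic operations.  *)
Definition direct_complexity_le (R : realType) (M N po c : nat) : Prop :=
  exists (T : program) (addr : nat -> nat -> nat),
    determines_b R M N po T addr /\ (cost (direct_program M N T addr) <= c)%N.

(* Main.v *)
Require Import Defs.
From HB Require Import structures.
From mathcomp Require Import all_boot all_order all_algebra reals.
From mathcomp Require Import boolp zify ring.

(** Each coefficient is a bounded expression in numbers taken from a few tables
    of length about N. With e = 0 for the even and e = 1 for the odd indices,
    z = l^2 / 2 and D k = 1 * 3 * ... * (2 k + 1), telescoping the two products
    ([prod_nat_fact], [prod_inv_odd]) gives, for m <= p <= n and m < n,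
<<
      v = (-1)^(p-m) z^(n-m) (2n+e)! (n-p) D(p+m+e)
            / ((n-m) (p-m)! (2m+e)! (n-p)! D(p+n+e)),
>>
    which is [v_gen_closed]. All arguments of the factorials, of D and of the
    powers are at most N. One table for each of k, k!, z^k, (-1)^k and D k, for
    0 <= k <= N, costs O(N) operations since each entry is obtained from the
    preceding one by a bounded number of operations ([store_recurrence]). Every
    coefficient then costs 9 operations ([computes_v_gen]), and each term of the
    direct formula costs 2. There are at most (M + 1) (N - M) coefficients and
    as many terms, so the total cost is O(N + (M + 1) (N - M)); for 0 < M < N
    both N and (M + 1) (N - M) are O((N - M) M), and for M = 0 they are
    O(N - M). *)

Set Implicit Arguments.
Unset Strict Implicit.
Unset Printing Implicit Defensive.

Import Order.TTheory GRing.Theory Num.Theory.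

Local Open Scope ring_scope.

(** * Memory and execution *)

Lemma onth_cat_some (A : Type) (s t : seq A) k x :
  onth s k = Some x -> onth (s ++ t) k = Some x.
Proof. by elim: s k => [|y s IH] [|k] //=; apply: IH. Qed.

Lemma onth_last (A : Type) (s : seq A) x : onth (rcons s x) (size s) = Some x.
Proof. by elim: s. Qed.

Lemma onth_nth (A : Type) (x0 : A) (s : seq A) k :
  (k < size s)%N -> onth s k = Some (nth x0 s k).
Proof. by elim: s k => [|y s IH] [|k] //= hk; apply: IH. Qed.

Lemma eval_cat (R : realType) (mem mem' : seq R) e x :
  eval mem e = Some x -> eval (mem ++ mem') e = Some x.
Proof.
elim: e x => [|k|o e1 IH1 e2 IH2] x //=; first exact: onth_cat_some.
case E1: (eval mem e1) => [x1|] //=; rewrite (IH1 _ E1) /=.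
by case E2: (eval mem e2) => [x2|] //=; rewrite (IH2 _ E2).
Qed.

Lemma run_cat (R : realType) (mem : seq R) P Q :
  run mem (P ++ Q) = obind (fun mem' => run mem' Q) (run mem P).
Proof.
by elim: P mem => [|e P IH] mem //=; case: (eval mem e) => [x|] //=.
Qed.

Lemma run_prefix (R : realType) (mem mem' : seq R) P :
  run mem P = Some mem' -> exists u, mem' = mem ++ u.
Proof.
elim: P mem => [|e P IH] mem /=; first by case=> <-; exists [::]; rewrite cats0.
case: (eval mem e) => [x|] //= /IH [u ->].
by exists (x :: u); rewrite cat_rcons.
Qed.

Lemma run_map (R : realType) (I : eqType) (mem : seq R) (E : I -> expr)
    (b : I -> R) (s : seq I) :
  {in s, forall i mem', eval (mem ++ mem') (E i) = Some (b i)} ->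
  run mem [seq E i | i <- s] = Some (mem ++ [seq b i | i <- s]).
Proof.
elim: s mem => [|i s IH] mem H /=; first by rewrite cats0.
have := H i (mem_head _ _) [::]; rewrite cats0 => -> /=.
rewrite IH ?cat_rcons // => j js mem'.
by rewrite cat_rcons; apply: H; rewrite in_cons js orbT.
Qed.

Lemma cost_cat P Q : cost (P ++ Q) = (cost P + cost Q)%N.
Proof. by rewrite /cost big_cat. Qed.

(** * Storing numbers that depend on l only *)

(** The quantity [x] is a function of l because one program has to serve all
    l > 0, and the coefficients do not depend on the polynomial; the existence
    of [mem] makes the absence of errors in [T] part of the assertion. *)
Definition has_value (R : realType) (N : nat) (T : program) (e : expr)
    (x : R -> R) : Prop :=
  forall (l : R) (a : N.+1.-tuple R), 0 < l ->
  exists2 mem, run (l :: a) T = Some mem & eval mem e = Some (x l).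

Definition computes (R : realType) (N : nat) (T : program) (c : nat)
    (x : R -> R) : Prop :=
  exists2 e, (expr_cost e <= c)%N & has_value N T e x.

Definition stored (R : realType) (N : nat) (T : program) (x : R -> R) : Prop :=
  exists k, has_value N T (Read k) x.

Definition extends (R : realType) (N : nat) (T : program) (c : nat)
    (T' : program) : Prop :=
  (cost T' <= cost T + c)%N /\
  forall e (x : R -> R), has_value N T e x -> has_value N T' e x.

Lemma extends_refl (R : realType) N T : extends R N T 0 T.
Proof. by split=> //; rewrite addn0. Qed.

Lemma extends_trans (R : realType) N T1 c T2 d T3 :
  extends R N T1 c T2 -> extends R N T2 d T3 -> extends R N T1 (c + d) T3.
Proof.
move=> [c12 v12] [c23 v23]; split=> [|e x /v12/v23//].
by rewrite addnA (leq_trans c23) // leq_add2r.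
Qed.

Lemma extends_stored (R : realType) N T c T' (x : R -> R) :
  extends R N T c T' -> stored N T x -> stored N T' x.
Proof. by move=> [_ v] [k /v]; exists k. Qed.

Lemma extends_computes (R : realType) N T c T' d (x : R -> R) :
  extends R N T c T' -> computes N T d x -> computes N T' d x.
Proof. by move=> [_ v] [e ce /v]; exists e. Qed.

Lemma stored_computes (R : realType) N T (x : R -> R) :
  stored N T x -> computes N T 0 x.
Proof. by case=> k; exists (Read k). Qed.

Lemma computes_eq (R : realType) N T c d (x y : R -> R) :
  computes N T c x -> (c <= d)%N -> (forall l, 0 < l -> x l = y l) ->
  computes N T d y.
Proof.
move=> [e ce He] cd xy; exists e; first exact: leq_trans cd.
by move=> l a l0; have [mem rT ev] := He l a l0; exists mem; rewrite // -xy.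
Qed.

Lemma stored_l (R : realType) N : stored N [::] (fun l : R => l).
Proof. by exists 0 => l a l0; exists (l :: a). Qed.

(** The conclusion says that [T] never fails. *)
Lemma stored_one (R : realType) N T (x : R -> R) :
  stored N T x -> has_value N T One (fun _ : R => 1).
Proof. by move=> [k Hk] l a l0; have [mem rT _] := Hk l a l0; exists mem. Qed.

Lemma computes_one (R : realType) N T (x : R -> R) :
  stored N T x -> computes N T 0 (fun _ : R => 1).
Proof. by move=> /stored_one; exists One. Qed.

Lemma computes_op (R : realType) N T o c d (x y z : R -> R) :
  (forall l, 0 < l -> apply_op o (x l) (y l) = Some (z l)) ->
  computes N T c x -> computes N T d y -> computes N T (c + d).+1 z.
Proof.
move=> xyz [e ce He] [f cf Hf]; exists (Op o e f).
  by rewrite /= ltnS leq_add.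
move=> l a l0; have [mem rT ev] := He l a l0; exists mem => //=.
have [mem' rT' ev'] := Hf l a l0; move: rT'; rewrite rT => -[?]; subst mem'.
by rewrite ev ev' /= xyz.
Qed.

Lemma computes_add (R : realType) N T c d (x y : R -> R) :
  computes N T c x -> computes N T d y ->
  computes N T (c + d).+1 (fun l => x l + y l).
Proof. exact: (computes_op (o := Add)). Qed.

Lemma computes_sub (R : realType) N T c d (x y : R -> R) :
  computes N T c x -> computes N T d y ->
  computes N T (c + d).+1 (fun l => x l - y l).
Proof. exact: (computes_op (o := Defs.Sub)). Qed.

Lemma computes_mul (R : realType) N T c d (x y : R -> R) :
  computes N T c x -> computes N T d y ->
  computes N T (c + d).+1 (fun l => x l * y l).
Proof. exact: (computes_op (o := Mul)). Qed.

Lemma computes_div (R : realType) N T c d (x y : R -> R) :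
  (forall l, 0 < l -> y l != 0) ->
  computes N T c x -> computes N T d y ->
  computes N T (c + d).+1 (fun l => x l / y l).
Proof.
move=> y0; apply: (computes_op (o := Div)) => l l0 /=.
by rewrite (negPf (y0 l l0)).
Qed.

Lemma store (R : realType) N T c (x : R -> R) :
  computes N T c x -> exists2 T', extends R N T c T' & stored N T' x.
Proof.
move=> [e ce He].
have runT l (a : N.+1.-tuple R) mem : 0 < l -> run (l :: a) T = Some mem ->
    run (l :: a) (T ++ [:: e]) = Some (rcons mem (x l)).
  move=> l0 rT; have [mem' rT' ev] := He l a l0.
  by move: rT'; rewrite run_cat rT => -[?]; subst mem'; rewrite /= ev.
exists (T ++ [:: e]).
  split; first by rewrite cost_cat leq_add2l /cost big_seq1.
  move=> f y Hf l a l0; have [mem rT ev] := Hf l a l0.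
  exists (rcons mem (x l)); first exact: runT.
  by rewrite -cats1; apply: eval_cat.
(* The new value is stored at the end of the memory, whose length does not
   depend on the input. *)
have szT l (a : N.+1.-tuple R) mem :
    run (l :: a) T = Some mem -> size mem = (N.+2 + size T)%N.
  move=> rT; have gen P : forall m m' : seq R, run m P = Some m' ->
      size m' = (size m + size P)%N.
    elim: P => [|f P IH] m m' /=; first by case=> <-; rewrite addn0.
    by case: (eval m f) => [v|] //= /IH ->; rewrite size_rcons addSnnS.
  by rewrite (gen _ _ _ rT) /= size_tuple.
exists (N.+2 + size T)%N => l a l0; have [mem rT _] := He l a l0.
exists (rcons mem (x l)); first exact: runT.
by rewrite -(szT _ _ _ rT) /= onth_last.
Qed.

(** The step is required in every extension [T'] of [T], so that it may read the
    preceding entry and, since extending preserves values, whatever [T] stored. *)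
Lemma store_recurrence (R : realType) N T c (x : nat -> R -> R) K :
  computes N T c (x 0) ->
  (forall T' k d, (k < K)%N -> extends R N T d T' -> stored N T' (x k) ->
     computes N T' c (x k.+1)) ->
  exists2 T', extends R N T (K.+1 * c) T' &
    forall k, (k <= K)%N -> stored N T' (x k).
Proof.
move=> x0 xS; elim: K xS => [|K IH] xS.
  have [T' TT' sT'] := store x0; exists T'; first by rewrite mul1n.
  by case.
have [T1 TT1 s1] := IH (fun T' k d kK => xS T' k d (ltnW kK)).
have [T2 T12 s2] := store (xS T1 K _ (leqnn _) TT1 (s1 K (leqnn _))).
exists T2; first by rewrite mulSnr; apply: extends_trans T12.
move=> k; rewrite leq_eqVlt => /orP [/eqP -> //|kK].
exact: extends_stored T12 (s1 _ kK).
Qed.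

Lemma store_family (R : realType) N T c (I : eqType) (s : seq I)
    (x : I -> R -> R) :
  {in s, forall i, computes N T c (x i)} ->
  exists2 T', extends R N T (size s * c) T' & {in s, forall i, stored N T' (x i)}.
Proof.
elim: s => [|i s IH] H /=; first by exists T; [exact: extends_refl|].
have [j js|T1 TT1 s1] := IH; first by apply: H; rewrite in_cons js orbT.
have [T2 T12 s2] := store (extends_computes TT1 (H i (mem_head _ _))).
exists T2; first by rewrite mulSnr; apply: extends_trans T12.
move=> j; rewrite in_cons => /orP [/eqP -> //|js].
exact: extends_stored T12 (s1 _ js).
Qed.

(** * Closed form of the coefficients *)

Definition odd_prod (k : nat) : nat := \prod_(0 <= r < k.+1) (2 * r + 1).

Lemma odd_prod_gt0 k : (0 < odd_prod k)%N.
Proof. by apply: prodn_gt0 => r; rewrite addn1. Qed.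

Lemma prod_inv_odd (R : realType) a b : (a <= b)%N ->
  \prod_(a.+1 <= r < b.+1) (1 / (2 * r + 1)%:R) =
  (odd_prod a)%:R / (odd_prod b)%:R :> R.
Proof.
move=> ab; have E k : (odd_prod k)%:R != 0 :> R.
  by rewrite pnatr_eq0 -lt0n odd_prod_gt0.
have -> : odd_prod b = (odd_prod a * \prod_(a.+1 <= r < b.+1) (2 * r + 1))%N.
  by rewrite /odd_prod -big_cat_nat.
rewrite natrM invfM mulrA mulfV ?E // mul1r natr_prod -prodfV.
by apply: eq_bigr => r _; rewrite mul1r.
Qed.

(** Multiplying by j, rather than writing (j - 1)!, makes the identity cover
    i = 0, where the product vanishes as soon as j > 0. *)
Lemma prod_nat_fact i j : (i <= j)%N ->
  ((\prod_(i <= r < j) r) * i`! * j = i * j`!)%N.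
Proof.
elim: j => [|j IH]; first by rewrite leqn0 => /eqP ->; rewrite muln0.
rewrite leq_eqVlt => /orP [/eqP ->|ij].
  by rewrite big_geq // mul1n mulnC.
by rewrite big_nat_recr //= factS mulnCA -IH //; ring.
Qed.

Definition v_gen (R : realType) (e : nat) (l : R) (p m n : nat) : R :=
  (-1) ^+ (p - m) * l ^+ (2 * (n - m)) * ((2 * n + e)`!)%:R
    / (2 ^+ (n - m) * ((n - m)`!)%:R * ((p - m)`!)%:R * ((2 * m + e)`!)%:R)
  * (\prod_(n - p <= r < n - m) r%:R)
  * (\prod_((p + m + e).+1 <= r < (p + n + e).+1) (1 / (2 * r + 1)%:R)).

Lemma v_even_gen (R : realType) (l : R) p m n : v_even l p m n = v_gen 0 l p m n.
Proof. by rewrite /v_gen !addn0. Qed.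

Lemma v_odd_gen (R : realType) (l : R) p m n : v_odd l p m n = v_gen 1 l p m n.
Proof. by rewrite /v_gen (addn1 (p + m)) (addn1 (p + n)). Qed.

(** The hypothesis p <= n is not strict: p = n occurs for the odd coefficients
    when M is even and p = M / 2, and the factor n - p then gives the value 0. *)
Lemma v_gen_closed (R : realType) e (l : R) p m n :
  (m <= p)%N -> (p <= n)%N -> (m < n)%N ->
  v_gen e l p m n =
  (-1) ^+ (p - m) * (l * l / 2) ^+ (n - m) * ((2 * n + e)`!)%:R * (n - p)%:R
    * (odd_prod (p + m + e))%:R
  / ((n - m)%:R * ((p - m)`!)%:R * ((2 * m + e)`!)%:R * ((n - p)`!)%:R
    * (odd_prod (p + n + e))%:R).
Proof.
move=> mp pn mn; rewrite /v_gen prod_inv_odd; last by lia.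
have F k : (k`!)%:R != 0 :> R by rewrite pnatr_eq0 -lt0n fact_gt0.
have D0 : (odd_prod (p + n + e))%:R != 0 :> R.
  by rewrite pnatr_eq0 -lt0n odd_prod_gt0.
have nm0 : (n - m)%:R != 0 :> R by rewrite pnatr_eq0 subn_eq0 -ltnNge.
have -> : \prod_(n - p <= r < n - m) r%:R =
    (n - p)%:R * ((n - m)`!)%:R / (n - m)%:R / ((n - p)`!)%:R :> R.
  rewrite -natrM -prod_nat_fact; last by lia.
  by rewrite !natrM natr_prod mulfK // mulfK.
have -> : (l * l / 2) ^+ (n - m) = l ^+ (2 * (n - m)) / 2 ^+ (n - m).
  by rewrite -expr2 expr_div_n exprM.
have t0 : 2 ^+ (n - m) != 0 :> R by rewrite expf_neq0 // pnatr_eq0.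
by field; rewrite !F D0 nm0 t0.
Qed.

(** * Computing the coefficients *)

Record tables (R : realType) (N : nat) (T : program) : Prop := Tables {
  table_nat : forall k, (k <= N)%N -> stored N T (fun _ : R => k%:R);
  table_fact : forall k, (k <= N)%N -> stored N T (fun _ : R => (k`!)%:R);
  table_pow : forall k, (k <= N)%N -> stored N T (fun l : R => (l * l / 2) ^+ k);
  table_sign : forall k, (k <= N)%N -> stored N T (fun _ : R => (-1) ^+ k);
  table_odd : forall k, (k <= N)%N -> stored N T (fun _ : R => (odd_prod k)%:R)
}.

(** An entry costs at most 1, 1, 4, 2 and 4 operations in the five tables; their
    sum is the factor 12. *)
Lemma tables_exist (R : realType) N :
  exists2 T, (cost T <= N.+1 * 12)%N & tables R N T.
Proof.
have s0 := @stored_l R N.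
have one T c T' (TT' : extends R N T c T') (sT : stored N T (fun l : R => l)) :
  computes N T' 0 (fun _ : R => 1) := computes_one (extends_stored TT' sT).
have rd := @stored_computes R N.
have [|T' k d _ TT' sk|T1 E1 S1] :=
  @store_recurrence R N [::] 1 (fun k _ => k%:R) N.
- have h := one _ _ _ (extends_refl R N _) s0.
  by apply: computes_eq (computes_sub h h) _ _ => // l _; rewrite subrr.
- apply: computes_eq (computes_add (rd _ _ sk) (one _ _ _ TT' s0)) _ _ => // l _.
  by rewrite -natr1.
have s1 := extends_stored E1 s0.
have [|T' k d kN TT' sk|T2 E2 S2] :=
  @store_recurrence R N T1 1 (fun k _ => (k`!)%:R) N.
- exact: computes_eq (one _ _ _ (extends_refl R N _) s1) _ _.
- have h := extends_stored TT' (S1 _ kN).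
  apply: computes_eq (computes_mul (rd _ _ h) (rd _ _ sk)) _ _ => // l _.
  by rewrite factS natrM.
have s2 := extends_stored E2 s1.
have [|T' k d kN TT' sk|T3 E3 S3] :=
  @store_recurrence R N T2 4 (fun k l => (l * l / 2) ^+ k) N.
- exact: computes_eq (one _ _ _ (extends_refl R N _) s2) _ _.
- have h := rd _ _ (extends_stored TT' s2).
  have o := one _ _ _ TT' s2.
  have two : forall l : R, 0 < l -> 1 + 1 != 0 :> R.
    by move=> l _; rewrite -[1 + 1]/(2%:R) pnatr_eq0.
  apply: computes_eq (computes_mul (computes_div two (computes_mul h h)
    (computes_add o o)) (rd _ _ sk)) _ _ => // l _.
  by rewrite exprS.
have s3 := extends_stored E3 s2.
have [|T' k d kN TT' sk|T4 E4 S4] :=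
  @store_recurrence R N T3 2 (fun k _ => (-1) ^+ k) N.
- exact: computes_eq (one _ _ _ (extends_refl R N _) s3) _ _.
- have o := one _ _ _ TT' s3.
  apply: computes_eq (computes_sub (computes_sub o o) (rd _ _ sk)) _ _ => // l _.
  by rewrite subrr sub0r exprS mulN1r.
have s4 := extends_stored E4 s3.
have E14 := extends_trans (extends_trans E2 E3) E4.
have [|T' k d kN TT' sk|T5 E5 S5] :=
  @store_recurrence R N T4 4 (fun k _ => (odd_prod k)%:R) N.
- apply: computes_eq (one _ _ _ (extends_refl R N _) s4) _ _ => // l _.
  by rewrite /odd_prod big_nat1.
- have o := one _ _ _ TT' s4.
  have h := rd _ _ (extends_stored (extends_trans E14 TT') (S1 _ kN)).
  apply: computes_eq (computes_mul (rd _ _ sk)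
    (computes_add (computes_add h h) o)) _ _ => // l _.
  by rewrite /odd_prod [in RHS]big_nat_recr // natrM mul2n -addnn !natrD.
have E35 := extends_trans E4 E5.
have E25 := extends_trans E3 E35.
have E15 := extends_trans E14 E5.
exists T5; last first.
  split=> k kN; [exact: extends_stored E15 (S1 _ kN)
  | exact: extends_stored E25 (S2 _ kN) | exact: extends_stored E35 (S3 _ kN)
  | exact: extends_stored E5 (S4 _ kN) | exact: S5].
have [c _] := extends_trans E1 E15.
move: c; rewrite {2}/cost big_nil; lia.
Qed.

Lemma computes_v_gen (R : realType) N T e p m n :
  tables R N T -> (m <= p)%N -> (p <= n)%N -> (m < n)%N ->
  (2 * n + e <= N)%N -> (p + n + e <= N)%N ->
  computes N T 9 (fun l : R => v_gen e l p m n).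
Proof.
move=> [Sn Sf Sz Ss Sd] mp pn mn h1 h2.
have rd := @stored_computes R N T.
have F k : (k`!)%:R != 0 :> R by rewrite pnatr_eq0 -lt0n fact_gt0.
have den0 (l : R) : 0 < l ->
    (n - m)%:R * ((p - m)`!)%:R * ((2 * m + e)`!)%:R * ((n - p)`!)%:R
      * (odd_prod (p + n + e))%:R != 0 :> R.
  by move=> _; rewrite !mulf_neq0 ?F // pnatr_eq0 -lt0n ?odd_prod_gt0 ?subn_gt0.
have num := computes_mul (computes_mul (computes_mul (computes_mul
  (rd _ (Ss (p - m)%N ltac:(lia))) (rd _ (Sz (n - m)%N ltac:(lia))))
  (rd _ (Sf (2 * n + e)%N ltac:(lia)))) (rd _ (Sn (n - p)%N ltac:(lia))))
  (rd _ (Sd (p + m + e)%N ltac:(lia))).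
have den := computes_mul (computes_mul (computes_mul (computes_mul
  (rd _ (Sn (n - m)%N ltac:(lia))) (rd _ (Sf (p - m)%N ltac:(lia))))
  (rd _ (Sf (2 * m + e)%N ltac:(lia)))) (rd _ (Sf (n - p)%N ltac:(lia))))
  (rd _ (Sd (p + n + e)%N ltac:(lia))).
apply: computes_eq (computes_div den0 num den) _ _ => // l _.
by rewrite v_gen_closed.
Qed.

Definition v_coef (R : realType) (M po i j : nat) (l : R) : R :=
  v_gen (odd i) l (if odd i then po else M./2) i./2 j./2.

(** The second conclusion is kept because there may be no coefficient at all
    (M = 0, N = 1), and then the third one says nothing about how [T] runs. *)
Lemma coefficients_exist (R : realType) M N po : odd_param M po ->
  exists T addr, (cost T <= N.+1 * 12 + (M.+1 * (N - M)) * 9)%N /\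
    has_value N T One (fun _ : R => 1) /\
    forall i j, (i <= M)%N -> (M < j <= N)%N -> odd i = odd j ->
      has_value N T (Read (addr i j)) (v_coef (R := R) M po i j).
Proof.
move=> hpo; have [T0 c0 tab] := tables_exist R N.
(* The direct formula only pairs indices of equal parity. *)
pose s := [seq ij <- [seq (i, j) | i <- iota 0 M.+1, j <- iota M.+1 (N - M)]
          | odd ij.1 == odd ij.2].
have memS i j : ((i, j) \in s) =
    [&& odd i == odd j, (i <= M)%N & (M < j <= N)%N].
  rewrite mem_filter; congr (_ && _); apply/allpairsP/andP => [|[hi hj]].
    by case=> -[i' j']; rewrite !mem_iota /fst /snd => -[hi hj [-> ->]]; lia.
  by exists (i, j); rewrite !mem_iota /fst /snd; split=> //; lia.
have [|T1 E1 S1] := @store_family R N T0 9 _ s (fun ij => v_coef M po ij.1 ij.2).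
  move=> [i j]; rewrite memS => /and3P [/eqP oij iM jMN] /=.
  by apply: computes_v_gen => //; move: hpo; rewrite /odd_param;
    case Ei: (odd i) => /=; lia.
have /choice [f Hf] : forall ij, exists k, ij \in s ->
    has_value N T1 (Read k) (v_coef (R := R) M po ij.1 ij.2).
  move=> ij; have [/S1 [k Hk]|ns] := boolP (ij \in s); first by exists k.
  by exists 0%N.
exists T1, (fun i j => f (i, j)); split; last first.
  split; first exact: stored_one (extends_stored E1 (table_nat tab (leq0n N))).
  by move=> i j iM jMN oij; apply: (Hf (i, j)); rewrite memS oij eqxx iM jMN.
have [c1 _] := E1; apply: leq_trans c1 _; apply: leq_add => //.
rewrite leq_mul2r /= size_filter (leq_trans (count_size _ _)) //.
by rewrite size_allpairs !size_iota.
Qed.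

(** * Evaluating the direct formula *)

Lemma eval_sum (R : realType) (mem : seq R) (addr : nat -> nat -> nat) i
    (js : seq nat) (f g : nat -> R) e x :
  eval mem e = Some x ->
  {in js, forall j, onth mem (addr i j) = Some (f j) /\
                    onth mem j.+1 = Some (g j)} ->
  eval mem (foldl (fun e j => Op Add e (Op Mul (Read (addr i j)) (Read j.+1)))
              e js) = Some (x + \sum_(j <- js) f j * g j).
Proof.
elim: js e x => [|j js IH] e x ex H /=; first by rewrite big_nil addr0.
have [hf hg] := H j (mem_head _ _).
rewrite big_cons addrA; apply: IH; first by move: hg => /= hg; rewrite ex hf /= hg.
by move=> k kjs; apply: H; rewrite in_cons kjs orbT.
Qed.

Lemma cost_sum (addr : nat -> nat -> nat) i e (js : seq nat) :
  expr_cost (foldl (fun e j => Op Add e (Op Mul (Read (addr i j)) (Read j.+1)))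
              e js) = (expr_cost e + 2 * size js)%N.
Proof.
elim: js e => [|j js IH] e /=; first by rewrite muln0 addn0.
by rewrite IH /=; lia.
Qed.

Definition direct_indices (M N i : nat) : seq nat :=
  if odd i then [seq (2 * n + 1)%N | n <- index_iota (uphalf M) (uphalf N)]
  else [seq (2 * n)%N | n <- index_iota (M./2).+1 (N./2).+1].

Lemma mem_direct_indices M N i j : j \in direct_indices M N i ->
  [/\ (M < j)%N, (j <= N)%N & odd i = odd j].
Proof.
rewrite /direct_indices; case: ifP => oi /mapP [n];
  by rewrite mem_index_iota => hn ->; split; lia.
Qed.

Lemma b_coef_sum (R : realType) M N po (l : R) (a : seq R) i :
  b_coef M N po l a i =
  a`_i + \sum_(j <- direct_indices M N i) v_coef M po i j l * a`_j.
Proof.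
have E : (2 * i./2 + odd i)%N = i by lia.
rewrite /b_coef /b_odd /b_even /direct_indices /v_coef.
case: ifP E => oi; rewrite ?oi ?addn0 => -> //=; rewrite big_map; congr (_ + _);
  apply: eq_bigr => n _.
  by rewrite v_odd_gen (_ : (2 * n + 1)./2 = n) //; lia.
by rewrite v_even_gen (_ : (2 * n)./2 = n) //; lia.
Qed.

Lemma cost_direct M N addr :
  (cost [seq direct_expr M N addr i | i <- iota 0 M.+1] <=
   M.+1 * (2 * (N - M)))%N.
Proof.
rewrite /cost big_map -{2}(size_iota 0 M.+1) -sum1_size big_distrl /=.
apply: leq_sum => i _.
rewrite /direct_expr /sum_expr cost_sum mul1n add0n leq_mul2l /=.
by case: ifP => _; rewrite size_map size_iota; lia.
Qed.

Lemma complexity_bound (R : realType) M N po : (M < N)%N -> odd_param M po ->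
  direct_complexity_le R M N po (N.+1 * 12 + (M.+1 * (N - M)) * 11).
Proof.
move=> MN hpo; have [T [addr [cT [T1 HT]]]] := @coefficients_exist R M N po hpo.
exists T, addr; split; last first.
  rewrite /direct_program cost_cat; have := cost_direct M N addr; lia.
move=> l a l0; have [mem rT _] := T1 l a l0; exists mem.
have Hv i j : (i <= M)%N -> (M < j <= N)%N -> odd i = odd j ->
    onth mem (addr i j) = Some (v_coef M po i j l).
  move=> iM jMN oij; have [mem' rT'] := HT i j iM jMN oij l a l0.
  by move: rT'; rewrite rT => -[<-].
have Ha k : (k <= N)%N -> onth mem k.+1 = Some a`_k.
  move=> kN; have [u ->] := run_prefix rT; apply: onth_cat_some => /=.
  by rewrite (onth_nth 0) // size_tuple.
split=> //.
- split=> m n hm hn.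
  + rewrite Hv; try by lia.
    by rewrite v_even_gen /v_coef !mul2n odd_double !doubleK.
  + rewrite Hv; try by lia.
    by rewrite v_odd_gen /v_coef !mul2n !addn1 /= odd_double /= !uphalf_double.
- rewrite /direct_program run_cat rT; apply: run_map => i.
  rewrite mem_iota => hi mem'; apply: eval_cat.
  rewrite b_coef_sum; apply: eval_sum; first by apply: Ha; lia.
  move=> j /mem_direct_indices [Mj jN oij].
  by split; [apply: Hv; lia | apply: Ha].
Qed.

(* For M = 0 the quantity (N - M) * M is 0, although b_0 is a sum of N./2 + 1  *)
(* terms; the bound is then N - M = N.                                        *)
Theorem proposition5p1 (R : realType) :
  exists C : nat, forall M N po : nat, (M < N)%N -> odd_param M po ->
    ((0 < M)%N -> direct_complexity_le R M N po (C * ((N - M) * M))) /\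
    (M = 0%N -> direct_complexity_le R M N po (C * (N - M))).
Proof.
have mono M N po c d : (c <= d)%N -> direct_complexity_le R M N po c ->
    direct_complexity_le R M N po d.
  move=> cd [T [addr [dT cT]]]; exists T, addr; split=> //.
  exact: leq_trans cd.
(* The constant comes from N + 1 <= 3 (N - M) M and M + 1 <= 2 M for
   0 < M < N; for M = 0 already N + 1 <= 2 N. *)
exists (3 * 12 + 2 * 11)%N => M N po MN hpo; split=> M0;
  apply: mono (complexity_bound R MN hpo); last by rewrite M0; lia.
have [d dN] : exists d, N = (M + d.+1)%N by exists (N - M.+1)%N; lia.
by rewrite dN addKn; case: M M0 {MN hpo dN} => // M _; nia.
Qed.
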